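(* Let $A$ and $B$ be lattices with zero, and let $A$ be locally finite. Then $A\otimes B$ is a lattice if and only if $A\otimes B$ is a capped tensor product.
   Context: A lattice is locally finite if each of its finitely generated sublattices is finite. Tensor product. For lattices $A$, $B$ with least elements $0$, put $\bot_{A,B}=(A\times\{0\})\cup(\{0\}\times B)$. A bi-ideal of $A\times B$ is a subset $I\subseteq A\times B$ which is a down-set (for the componentwise order), contains $\bot_{A,B}$, and is closed under lateral joins: $(a,b_0),(a,b_1)\in I$ implies $(a,b_0\vee b_1)\in I$, and $(a_0,b),(a_1,b)\in I$ implies $(a_0\vee a_1,b)\in I$. Ordered by inclusion, the bi-ideals form an algebraic lattice $A\,\bar\otimes\, B$. For $a\in A$, $b\in B$ the pure tensor is the bi-ideal $a\otimes b=\bot_{A,B}\cup\{(x,y)\in A\times B : x\le a,\ y\le b\}$. The tensor product $A\otimes B$ is the join-semilattice with zero of compact elements of $A\,\bar\otimes\,B$, i.e. the set of all finite joins (in $A\,\bar\otimes\,B$) of pure tensors, ordered by inclusion. ''$A\otimes B$ is a lattice'' means that this ordered set is a lattice. $A\otimes B$ is a capped tensor product if every element of $A\otimes B$ is a finite union (as sets) of pure tensors. *)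

(* Defs.v *)
From HB Require Import structures.
From mathcomp Require Import all_boot all_order all_classical.

Set Implicit Arguments.
Unset Strict Implicit.
Unset Printing Implicit Defensive.

Import Order.TTheory.
Local Open Scope classical_set_scope.

Definition is_lattice d (T : porderType d) : Prop :=
  forall x y : T,
    supremums [set x; y] !=set0 /\ infimums [set x; y] !=set0.

Definition is_sublattice d (L : latticeType d) (S : set L) : Prop :=
  forall x y, S x -> S y -> S (Order.meet x y) /\ S (Order.join x y).

(* [smallest is_sublattice X] is the sublattice of L generated by X. *)
Definition locally_finite d (L : latticeType d) : Prop :=
  forall X : set L, finite_set X -> finite_set (smallest (@is_sublattice d L) X).

Section TensorProduct.
Context {dA dB : Order.disp_t} {A : bLatticeType dA} {B : bLatticeType dB}.
Implicit Types (I : set (A * B)) (F G : set (set (A * B))).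

Definition bi_bot : set (A * B) := [set p | p.1 = \bot%O \/ p.2 = \bot%O].

Definition bi_ideal I : Prop :=
  [/\ forall a b a' b', I (a, b) -> (a' <= a)%O -> (b' <= b)%O -> I (a', b'),
      bi_bot `<=` I,
      forall a b0 b1, I (a, b0) -> I (a, b1) -> I (a, Order.join b0 b1) &
      forall a0 a1 b, I (a0, b) -> I (a1, b) -> I (Order.join a0 a1, b)].

Definition pure_tensor (a : A) (b : B) : set (A * B) :=
  bi_bot `|` [set p | (p.1 <= a)%O /\ (p.2 <= b)%O].

(* The join of a family of bi-ideals in the lattice of all bi-ideals; see
   [bi_joinP]. *)
Definition bi_join F : set (A * B) := smallest bi_ideal (\bigcup_(I in F) I).

(* Finite joins of pure tensors; see [tensor_compactP] for their description
   as the compact elements of the lattice of bi-ideals. *)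
Definition is_tensor I : Prop :=
  exists s : seq (A * B),
    I = bi_join [set pure_tensor p.1 p.2 | p in [set` s]].

Definition bi_compact I : Prop :=
  bi_ideal I /\
  forall F, F `<=` bi_ideal -> I `<=` bi_join F ->
    exists2 G, finite_set G & G `<=` F /\ I `<=` bi_join G.

End TensorProduct.

Section TensorType.
Context {dA dB : Order.disp_t} (A : bLatticeType dA) (B : bLatticeType dB).

Definition tensor : Type := set_type (@is_tensor dA dB A B).

HB.instance Definition _ := [isSub of tensor for @sval _ _].
HB.instance Definition _ := [Choice of tensor by <:].
(* The order restricted from [set (A * B)] is inclusion; see [tensor_leP]. *)
HB.instance Definition _ :=
  [SubChoice_isSubPOrder of tensor by <: with set_display].

Definition capped_tensor : Prop :=
  forall I : tensor, exists s : seq (A * B),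
    val I = \bigcup_(p in [set` s]) pure_tensor p.1 p.2.

End TensorType.

Section Facts.
Context {dA dB : Order.disp_t} {A : bLatticeType dA} {B : bLatticeType dB}.
Implicit Types (I : set (A * B)) (F G : set (set (A * B))).

Lemma tensor_leP (I J : tensor A B) : reflect (val I `<=` val J) (I <= J)%O.
Proof. exact: asboolP. Qed.

Lemma bi_ideal_bigcap F : F `<=` bi_ideal -> bi_ideal (\bigcap_(I in F) I).
Proof.
move=> FI; split.
- move=> a b a' b' Iab aa bb I FI'; have [h _ _ _] := FI _ FI'.
  exact: h (Iab _ FI') aa bb.
- by move=> p bp I FI'; have [_ h _ _] := FI _ FI'; exact: h.
- move=> a b0 b1 I0 I1 I FI'; have [_ _ h _] := FI _ FI'.
  by apply: h; [exact: I0|exact: I1].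
- move=> a b0 b1 I0 I1 I FI'; have [_ _ _ h] := FI _ FI'.
  by apply: h; [exact: I0|exact: I1].
Qed.

Lemma bi_ideal_join F : bi_ideal (bi_join F).
Proof. by apply: bi_ideal_bigcap => I []. Qed.

Lemma pure_tensor_sub I (a : A) (b : B) : bi_ideal I ->
  I (a, b) -> pure_tensor a b `<=` I.
Proof.
by move=> [dI bI _ _] Iab [x y] [/bI//|/= [xa yb]]; apply: dI Iab xa yb.
Qed.

Lemma pure_tensor_ideal (a : A) (b : B) : bi_ideal (pure_tensor a b).
Proof.
split.
- move=> x y x' y' [[/= ->|/= ->]|[/= xa yb]] xx yy.
  + by left; left => /=; apply/eqP; rewrite -lex0.
  + by left; right => /=; apply/eqP; rewrite -lex0.
  + by right; split => /=; [apply: le_trans xx xa|apply: le_trans yy yb].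
- by move=> p; left.
- move=> x y0 y1 [[/= x0|/= ->]|[/= xa yb]]; first by move=> _; left; left.
  + by rewrite join0x.
  + move=> [[/= x0|/= ->]|[/= _ yb']]; first by left; left.
      by rewrite joinx0; right.
    by right; split; rewrite //= leUx yb.
- move=> x0 x1 y [[/= ->|/= y0]|[/= xa yb]].
  + by rewrite join0x.
  + by move=> _; left; right.
  + move=> [[/= ->|/= y0]|[/= xa' _]]; last by right; split; rewrite //= leUx xa.
      by rewrite joinx0; right.
    by left; right.
Qed.

Lemma bi_joinP F J : bi_ideal J ->
  (bi_join F `<=` J) <-> (forall I, F I -> I `<=` J).
Proof.
move=> iJ; split=> [h I FI p Ip|h].
  by apply: h; apply: sub_gen_smallest; exists I.
by apply: smallest_sub => // p [I FI]; exact: h.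
Qed.

Lemma bi_join_mono F G : F `<=` G -> bi_join F `<=` bi_join G.
Proof.
move=> FG; apply/bi_joinP; first exact: bi_ideal_join.
by move=> I FI p Ip; apply: sub_gen_smallest; exists I => //; exact: FG.
Qed.

Lemma bi_join_finitary F p : F `<=` bi_ideal -> bi_join F p ->
  exists2 G, finite_set G & G `<=` F /\ bi_join G p.
Proof.
move=> FI.
pose U := [set q | exists2 G, finite_set G & G `<=` F /\ bi_join G q].
suff : bi_join F `<=` U by apply.
apply/bi_joinP; last first.
  move=> I FI' q Iq; exists [set I]; first exact: finite_set1.
  by split=> [_ -> //|]; apply: sub_gen_smallest; exists I.
split.
- move=> a b a' b' [G fG [GF Gp]] aa bb; exists G => //; split=> //.
  by have [h _ _ _] := bi_ideal_join G; apply: h Gp aa bb.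
- move=> q bq; exists set0 => //; split=> //.
  by have [_ h _ _] := bi_ideal_join set0; exact: h.
- move=> a b0 b1 [G fG [GF Gp]] [H fH [HF Hp]].
  exists (G `|` H); first by rewrite finite_setU.
  split; first by move=> I [/GF|/HF].
  have [_ _ h _] := bi_ideal_join (G `|` H); apply: h.
    by apply: bi_join_mono Gp; exact: subsetUl.
  by apply: bi_join_mono Hp; exact: subsetUr.
- move=> a b0 b1 [G fG [GF Gp]] [H fH [HF Hp]].
  exists (G `|` H); first by rewrite finite_setU.
  split; first by move=> I [/GF|/HF].
  have [_ _ _ h] := bi_ideal_join (G `|` H); apply: h.
    by apply: bi_join_mono Gp; exact: subsetUl.
  by apply: bi_join_mono Hp; exact: subsetUr.
Qed.

Lemma tensor_compactP I : is_tensor I <-> bi_compact I.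
Proof.
split=> [[s ->]|[iI cI]].
  split=> [|F FI sF]; first exact: bi_ideal_join.
  have {}sF p : p \in s -> bi_join F p.
    move=> ps; apply: sF; apply: sub_gen_smallest.
    by exists (pure_tensor p.1 p.2); [exists p|right].
  suff [G fG [GF sG]] : exists2 G, finite_set G &
      G `<=` F /\ forall p, p \in s -> bi_join G p.
    exists G => //; split=> //; apply/bi_joinP; first exact: bi_ideal_join.
    move=> _ [[a b] /sG Gp <-]; apply: pure_tensor_sub Gp.
    exact: bi_ideal_join.
  elim: s sF => [_|p s IHs sF]; first by exists set0 => //; split.
  have [|G fG [GF sG]] := IHs.
    by move=> q qs; apply: sF; rewrite inE qs orbT.
  have [H fH [HF sH]] := bi_join_finitary FI (sF p (mem_head _ _)).
  exists (G `|` H); first by rewrite finite_setU.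
  split=> [J [/GF|/HF]//|q]; rewrite inE => /orP[/eqP ->|/sG].
    by apply: bi_join_mono sH; exact: subsetUr.
  by apply: bi_join_mono; exact: subsetUl.
have [|p Ip|G fG [GF IG]] := cI [set pure_tensor p.1 p.2 | p in I].
- by move=> _ [p _ <-]; exact: pure_tensor_ideal.
- apply: sub_gen_smallest; exists (pure_tensor p.1 p.2); last by right.
  by exists p.
have [s sI Gs] : exists2 s : seq (A * B), [set` s] `<=` I &
    G = [set pure_tensor p.1 p.2 | p in [set` s]].
  have [X [XI fX XG]] : exists X, [/\ X `<=` I, finite_set X &
      G = [set pure_tensor p.1 p.2 | p in X]].
    pose g J := xget (\bot%O, \bot%O) [set p : A * B | I p /\ pure_tensor p.1 p.2 = J].
    have gP J : G J -> I (g J) /\ pure_tensor (g J).1 (g J).2 = J.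
      by move=> /GF [p Ip pJ]; rewrite /g; case: xgetP => [q _ []//|/(_ p)[]].
    exists (g @` G); split; first by move=> _ [J /gP[? _] <-].
      exact: finite_image.
    apply/seteqP; split=> [J GJ|_ [_ [J GJ <-] <-]].
      by exists (g J); [exists J|case: (gP J GJ)].
    by have [_ ->] := gP J GJ.
  by have /finite_seqP[s Xs] := fX; exists s; rewrite -Xs.
exists s; apply/seteqP; rewrite -Gs; split=> //.
apply/bi_joinP=> // J /GF[[a b] Ip <-]; exact: pure_tensor_sub.
Qed.

End Facts.

(* Main.v *)
Require Import Defs.
From mathcomp Require Import all_boot all_order all_classical.

(**
Infima in A ⊗ B, when they exist, are intersections, since every pure tensor
below both elements lies below their infimum. As the intersection of two pure
tensors is a pure tensor, capped implies lattice.

Conversely, let I be the join of the pure tensors a_i ⊗ b_i, and let S be the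
finite sublattice of A generated by 0 and the a_i. Every (x, y) in I lies
below some (a, y) in I with a in S, so I is capped as soon as the ideal
I_a = {b | (a, b) in I} is principal for each nonzero a in S. This goes by
induction on a. If a is the join of z, z' < a in S, then I_a is the
intersection of I_z and I_z'. Otherwise a is join-irreducible in S; the tensor
I ∩ (a ⊗ c), where c is the join of the b_i, is the join of finitely many
x_j ⊗ y_j, and I_a is generated by the join of the y_j lying in it: the other
generators sit below elements z < a of S, whose joins never reach a.
*)

Set Implicit Arguments.
Unset Strict Implicit.
Unset Printing Implicit Defensive.

Import Order.TTheory.
Local Open Scope order_scope.
Local Open Scope classical_set_scope.

(** * Counting below an element; generated sublattices *)

(** The element [x] itself is counted on the right but not on the left. This count is the measure
    for induction along a finite part of the order. *)
Lemma count_lt_lt d (T : porderType d) (s : seq T) (x y : T) :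
  x \in s -> x < y -> (count (fun z => z < x)%O s < count (fun z => z < y)%O s)%N.
Proof.
move=> xs xy; pose p z := z < x; rewrite -[count _ s]/(count p s).
apply: (@leq_trans (count p s + count_mem x s)).
  by rewrite -addn1 leq_add2l -has_count has_pred1.
rewrite -count_predUI [X in (_ + X)%N](eq_count (a2 := pred0)) => [|z /=].
  rewrite count_pred0 addn0; apply: sub_count => z /= /orP[/lt_trans|/eqP->] //.
  exact.
by rewrite /p; case: eqP => [->|]; rewrite ?ltxx ?andbF.
Qed.

Lemma smallest_sublattice d (L : latticeType d) (X : set L) :
  is_sublattice (smallest (@is_sublattice d L) X).
Proof.
move=> x y Sx Sy; split=> T [subT XT].
  by case: (subT x y (Sx _ (conj subT XT)) (Sy _ (conj subT XT))).
by case: (subT x y (Sx _ (conj subT XT)) (Sy _ (conj subT XT))).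
Qed.

(** * Intersections and finite joins of pure tensors *)

Section Tensor.
Context {dA dB : Order.disp_t} {A : bLatticeType dA} {B : bLatticeType dB}.
Implicit Types (I J : set (A * B)) (s : seq (A * B)).

Lemma pure_tensorI (a c : A) (b d : B) :
  pure_tensor a b `&` pure_tensor c d =
  pure_tensor (Order.meet a c) (Order.meet b d).
Proof.
by apply/seteqP; split=> [p [[bp|[pa pb]] [bp'|[pc pd]]]|p [bp|/= []]];
  rewrite /pure_tensor /= ?lexI; [left|left|left|right; rewrite pa pb pc pd|
  split; left|move=> /andP[pa pc] /andP[pb pd]; split; right].
Qed.

Lemma bi_ideal_setI I J : bi_ideal I -> bi_ideal J -> bi_ideal (I `&` J).
Proof.
move=> iI iJ; have -> : I `&` J = \bigcap_(K in [set I; J]) K.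
  by rewrite bigcap_setU !bigcap_set1.
by apply: bi_ideal_bigcap => K [->|->].
Qed.

Lemma bi_ideal_bigjoin I (a : A) (r : seq B) (P : pred B) : bi_ideal I ->
  (forall y, P y -> I (a, y)) -> I (a, \join_(y <- r | P y) y).
Proof.
move=> [_ bI jI _] IP; apply: (big_ind (fun y => I (a, y))) => //.
  by apply: bI; right.
by move=> *; apply: jI.
Qed.

Lemma bi_join_seqP s J : bi_ideal J ->
  (bi_join [set pure_tensor p.1 p.2 | p in [set` s]] `<=` J) <->
  (forall p, p \in s -> J p).
Proof.
move=> iJ; rewrite bi_joinP//; split=> [sJ p ps|sJ _ [[a b] /sJ Jab <-]].
  by apply: (sJ (pure_tensor p.1 p.2)); [exists p|right].
exact: pure_tensor_sub.
Qed.

Lemma bi_join_seq_mem s p :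
  p \in s -> bi_join [set pure_tensor p.1 p.2 | p in [set` s]] p.
Proof.
by move: p; apply/bi_join_seqP => //; exact: bi_ideal_join.
Qed.

(** A union of pure tensors that is already a bi-ideal coincides with their join. *)
Lemma is_tensor_bigcup I s : bi_ideal I ->
  I = \bigcup_(p in [set` s]) pure_tensor p.1 p.2 -> is_tensor I.
Proof.
move=> iI Is; exists s; apply/seteqP; split; last first.
  by apply/bi_join_seqP => // p ps; rewrite Is; exists p => //; right.
rewrite {1}Is => q [[a b] /= /bi_join_seq_mem ps]; apply: pure_tensor_sub ps _.
exact: bi_ideal_join.
Qed.

Lemma is_tensor_pure (a : A) (b : B) : is_tensor (pure_tensor a b).
Proof.
apply: (@is_tensor_bigcup _ [:: (a, b)]); first exact: pure_tensor_ideal.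
by rewrite set_cons1 bigcup_set1.
Qed.

Lemma is_tensor_ideal I : is_tensor I -> bi_ideal I.
Proof. by move=> [s ->]; exact: bi_ideal_join. Qed.

End Tensor.

(** * Infima as intersections; capped implies lattice *)

Section LatticeIffCapped.
Context {dA dB : Order.disp_t} {A : bLatticeType dA} {B : bLatticeType dB}.
Implicit Types (I J : tensor A B).

Lemma tensorP I : is_tensor (val I).
Proof. by apply: set_mem; exact: valP. Qed.

Lemma is_tensor_lift (X : set (A * B)) :
  is_tensor X -> exists I : tensor A B, val I = X.
Proof. by move=> tX; exists (exist _ X (mem_set tX)). Qed.

Lemma tensor_setI I J : is_lattice (tensor A B) -> is_tensor (val I `&` val J).
Proof.
move=> /(_ I J)[_ [K [lbK glbK]]].
have KI : val K `<=` val I by apply/tensor_leP/lbK; left.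
have KJ : val K `<=` val J by apply/tensor_leP/lbK; right.
suff -> : val I `&` val J = val K by exact: tensorP.
apply/seteqP; split=> [[a b] [Iab Jab]|p Kp]; last by split; [exact: KI|exact: KJ].
have [T Tab] := is_tensor_lift (is_tensor_pure a b).
have /tensor_leP : T <= K; last by apply; rewrite Tab; right.
apply: glbK => L [->|->]; apply/tensor_leP; rewrite Tab;
  apply: pure_tensor_sub => //;
  exact/is_tensor_ideal/tensorP.
Qed.

Lemma capped_lattice : capped_tensor A B -> is_lattice (tensor A B).
Proof.
move=> cap I J; split.
  have [s Is] := tensorP I; have [t Jt] := tensorP J.
  have [|U UE] :=
    @is_tensor_lift (bi_join [set pure_tensor p.1 p.2 | p in [set` s ++ t]]).
    by exists (s ++ t).
  exists U; split=> [K [->|->]|K ubK].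
  - apply/tensor_leP; rewrite Is UE; apply/bi_join_seqP => [|p ps].
      exact: bi_ideal_join.
    by apply: bi_join_seq_mem; rewrite mem_cat ps.
  - apply/tensor_leP; rewrite Jt UE; apply/bi_join_seqP => [|p ps].
      exact: bi_ideal_join.
    by apply: bi_join_seq_mem; rewrite mem_cat ps orbT.
  apply/tensor_leP; rewrite UE; apply/bi_join_seqP => [|p]; first exact/is_tensor_ideal/tensorP.
  rewrite mem_cat => /orP[ps|pt].
    have /tensor_leP : I <= K by apply: ubK; left.
    by apply; rewrite Is; exact: bi_join_seq_mem.
  have /tensor_leP : J <= K by apply: ubK; right.
  by apply; rewrite Jt; exact: bi_join_seq_mem.
have [s Is] := cap I; have [t Jt] := cap J.
have [|M ME] := @is_tensor_lift (val I `&` val J).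
  (* Distributing the intersection over both unions leaves the pairwise intersections of pure
     tensors. *)
  apply: (@is_tensor_bigcup _ _ _ _ _
    [seq (Order.meet p.1 q.1, Order.meet p.2 q.2) | p <- s, q <- t]).
    by apply: bi_ideal_setI; exact/is_tensor_ideal/tensorP.
  rewrite Is Jt; apply/seteqP; split=> [x [[p ps px] [q qt qx]]|x].
    exists (Order.meet p.1 q.1, Order.meet p.2 q.2); last by rewrite -pure_tensorI.
    by apply/allpairsP; exists (p, q).
  move=> [_ /allpairsP[[p q] /= [ps qt ->]]]; rewrite -pure_tensorI => -[px qx].
  by split; [exists p|exists q].
exists M; split=> [K [->|->]|K lbK].
- by apply/tensor_leP; rewrite ME; exact: subIsetl.
- by apply/tensor_leP; rewrite ME; exact: subIsetr.
apply/tensor_leP => p Kp; rewrite ME.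
have /tensor_leP KI : K <= I by apply: lbK; left.
have /tensor_leP KJ : K <= J by apply: lbK; right.
by split; [exact: KI|exact: KJ].
Qed.

End LatticeIffCapped.

(** * Lattice implies capped: fibers over a finite sublattice *)

Lemma locally_finite_seq d (L : latticeType d) (r : seq L) : locally_finite L ->
  exists2 s : seq L, {subset r <= s} & is_sublattice [set` s].
Proof.
move=> /(_ [set` r] (finite_seq r)) /finite_seqP[s sE]; exists s.
  by move=> x xr; have : [set` s] x by rewrite -sE; apply: sub_gen_smallest.
by rewrite -sE; exact: smallest_sublattice.
Qed.

Section Capped.
Context {dA dB : Order.disp_t} {A : bLatticeType dA} {B : bLatticeType dB}.
Context (s : seq A) (t : seq (A * B)) (s0 : \bot \in s).
Context (s_sub : is_sublattice [set` s]) (s_t : forall p, p \in t -> p.1 \in s).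

Let I := bi_join [set pure_tensor p.1 p.2 | p in [set` t]].
Let iI : bi_ideal I := @bi_ideal_join _ _ _ _ _.

(** The pairs with this property form a bi-ideal containing the generators. The case [y = \bot] is
    separate because [x] is then arbitrary and may lie below no member of [s]. *)
Lemma bi_join_seq_cover (x : A) (y : B) : I (x, y) ->
  y = \bot \/ exists a, [/\ a \in s, x <= a & I (a, y)].
Proof.
have [dI bI bjI ajI] := iI.
pose U := [set p : A * B |
  p.2 = \bot \/ exists a, [/\ a \in s, p.1 <= a & I (a, p.2)]].
suff : I `<=` U by move=> /[apply].
apply/bi_join_seqP => [|[a b] abt]; last first.
  by right; exists a; split; [exact: s_t abt|exact: lexx|exact: bi_join_seq_mem].
split=> [a b a' b' [/= ->|[z [zs az Izb]]] aa bb|p [p0|p0]||].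
- by left; apply/eqP; rewrite -lex0.
- by right; exists z; split=> //=; [exact: le_trans az|exact: dI Izb _ _].
- right; exists \bot; split=> //; first by rewrite p0.
  by apply: bI; left.
- by left.
- move=> a b0 b1 [/= ->|[z [zs az Iz]]]; first by rewrite join0x.
  move=> [/= ->|[z' [zs' az' Iz']]].
    by rewrite joinx0; right; exists z.
  (* The meet is still above the first coordinate, and its fiber contains those of [z] and [z']. *)
  right; exists (Order.meet z z'); split=> /=.
  + by case: (s_sub zs zs').
  + by rewrite lexI az.
  + by apply: bjI; [exact: dI Iz (leIl _ _) _|exact: dI Iz' (leIr _ _) _].
- move=> a0 a1 b [/= ->|[z [zs az Iz]]]; first by move=> _; left.
  move=> [/= ->|[z' [zs' az' Iz']]]; first by left.
  right; exists (Order.join z z'); split=> /=.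
  + by case: (s_sub zs zs').
  + exact: leU2.
  + exact: ajI.
Qed.

Lemma bi_join_seq_bounded (a : A) (b : B) : a != \bot -> I (a, b) ->
  b <= \join_(p <- t) p.2.
Proof.
move=> a0 Iab.
suff /(_ _ Iab)[[/= aE|/= ->]|[]//] :
    I `<=` pure_tensor (\join_(p <- t) p.1) (\join_(p <- t) p.2).
- by rewrite aE eqxx in a0.
- exact: le0x.
apply/bi_join_seqP => [|p pt]; first exact: pure_tensor_ideal.
by right; split; exact: joins_sup_seq.
Qed.

Context (lat : is_lattice (tensor A B)).

Lemma irreducible_fiber_principal (a : A) : a \in s -> a != \bot ->
  (forall z z', z \in s -> z' \in s -> z < a -> z' < a -> Order.join z z' <> a) ->
  exists m, forall b, I (a, b) <-> b <= m.
Proof.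
move=> as_ a0 irr; have [dI bI bjI ajI] := iI.
pose c := \join_(p <- t) p.2.
(* The lattice hypothesis enters here: it makes this intersection finitely generated. *)
have [r Jr] : is_tensor (I `&` pure_tensor a c).
  have [|K <-] := @is_tensor_lift _ _ A B I; first by exists t.
  by have [L <-] := is_tensor_lift (is_tensor_pure a c); exact: tensor_setI.
pose m := \join_(p <- r | `[< I (a, p.2) >]) p.2.
have Iam : I (a, m).
  rewrite /m -(big_map snd (fun y => `[< I (a, y) >]) id).
  by apply: bi_ideal_bigjoin => // y /asboolP.
(* [V] is designed to be a bi-ideal containing the generators [r], while its fiber at [a] has no
   element outside the down-set of [m]. *)
pose V := [set p : A * B | [\/ p.2 = \bot,
  exists z, [/\ z \in s, z < a, p.1 <= z & I (z, p.2)] |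
  p.1 <= a /\ p.2 <= m]].
have IV : I `&` pure_tensor a c `<=` V.
  rewrite Jr; apply/bi_join_seqP => [|[x y] xyr]; last first.
    have [/= Ixy] : (I `&` pure_tensor a c) (x, y).
      by rewrite Jr; exact: bi_join_seq_mem.
    have [->|[z [zs xz Izy]]] := bi_join_seq_cover Ixy; first by constructor 1.
    move=> [[/= ->|/= ->]|[/= xa _]]; last 1 first.
    - have Iy : I (Order.meet z a, y) by exact: dI Izy (leIl _ _) _.
      (* If the meet of [z] and [a] is [a], then [y] is one of the joinands of [m]; otherwise this
         meet is the element of [s] strictly below [a] required by the second clause. *)
      have := leIr a z; rewrite le_eqVlt => /orP[/eqP zaE|lt_za].
        constructor 3; split=> //=; apply: (@joins_sup_seq _ _ _ r _ snd (x, y)) => //.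
        by apply/asboolP; rewrite -zaE.
      constructor 2; exists (Order.meet z a); split=> //=.
        by case: (s_sub zs as_).
      by rewrite lexI xz.
    - constructor 2; exists \bot; split=> //=; first by rewrite lt0x.
      by apply: bI; left.
    - by constructor 1.
  split.
  - move=> x y x' y' [/= ->|[z [/= zs za xz Izy]]|[/= xa ym]] xx yy.
    + by constructor 1; apply/eqP; rewrite -lex0.
    + constructor 2; exists z; split=> //=; first exact: le_trans xz.
      exact: dI Izy _ _.
    + by constructor 3; split=> /=; [exact: le_trans xa|exact: le_trans ym].
  - move=> [x y] [/= ->|/= ->]; last by constructor 1.
    constructor 2; exists \bot; split=> //=; first by rewrite lt0x.
    by apply: bI; left.
  - move=> x y0 y1 [/= ->|[z [/= zs za xz Izy]]|[/= xa ym]].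
    + by rewrite join0x.
    + move=> [/= ->|[z' [/= zs' za' xz' Izy']]|[/= xa ym]].
      * by rewrite joinx0; constructor 2; exists z.
      * constructor 2; exists (Order.meet z z'); split=> /=.
        - by case: (s_sub zs zs').
        - exact: le_lt_trans (leIl _ _) za.
        - by rewrite lexI xz.
        - by apply: bjI; [exact: dI Izy (leIl _ _) _|exact: dI Izy' (leIr _ _) _].
      (* As [z < a], the fiber at [z] contains [m], hence also [y1]. *)
      * constructor 2; exists z; split=> //=; apply: bjI => //.
        exact: dI Iam (ltW za) ym.
    + move=> [/= ->|[z' [/= zs' za' xz' Izy']]|[/= _ ym']].
      * by rewrite joinx0; constructor 3.
      * constructor 2; exists z'; split=> //=; apply: bjI => //.
        exact: dI Iam (ltW za') ym.
      * by constructor 3; split=> //=; rewrite leUx ym.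
  - move=> x0 x1 y [/= ->|[z [/= zs za xz Izy]]|[/= xa ym]].
    + by move=> _; constructor 1.
    + move=> [/= ->|[z' [/= zs' za' xz' Izy']]|[/= xa ym]].
      * by constructor 1.
      * constructor 2; exists (Order.join z z'); split=> /=.
        - by case: (s_sub zs zs').
        (* Irreducibility of [a] keeps the join strictly below [a]. *)
        - rewrite lt_neqAle leUx (ltW za) (ltW za') !andbT.
          exact/eqP/irr.
        - exact: leU2.
        - exact: ajI.
      * by constructor 3; split=> //=; rewrite leUx xa (le_trans xz (ltW za)).
    + move=> [/= ->|[z' [/= zs' za' xz' Izy']]|[/= xa' _]].
      * by constructor 1.
      * by constructor 3; split=> //=; rewrite leUx xa (le_trans xz' (ltW za')).
      * by constructor 3; split=> //=; rewrite leUx xa.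
exists m => b; split=> [Iab|bm]; last exact: dI Iam (lexx _) bm.
(* The bound [c] puts [(a, b)] in the intersection; the second clause of [V] would then give
   [a <= z < a]. *)
have /IV : (I `&` pure_tensor a c) (a, b).
  by split=> //; right; split=> //=; exact: bi_join_seq_bounded Iab.
move=> [/= ->|[z [/= _ za az _]]|[]//]; first exact: le0x.
by have := le_lt_trans az za; rewrite ltxx.
Qed.

Lemma fiber_principal (a : A) : a \in s -> a != \bot ->
  exists m, forall b, I (a, b) <-> b <= m.
Proof.
have [dI bI bjI ajI] := iI.
(* Induction on the number of members of [s] strictly below [a]. *)
have [n] := ubnP (count (fun z => z < a) s); elim: n a => // n IHn a.
rewrite ltnS => an as_ a0.
have [[z [z' [zs zs' za za' zz']]]|irr] := pselect (exists z z',
    [/\ z \in s, z' \in s, z < a, z' < a & Order.join z z' = a]); last first.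
  apply: irreducible_fiber_principal => // z z' zs zs' za za' zz'.
  by apply: irr; exists z, z'.
have z0 : z != \bot by apply: contraTneq za' => zE; rewrite -zz' zE join0x ltxx.
have z0' : z' != \bot by apply: contraTneq za => zE; rewrite -zz' zE joinx0 ltxx.
have [m mP] := IHn z (leq_trans (count_lt_lt zs za) an) zs z0.
have [m' mP'] := IHn z' (leq_trans (count_lt_lt zs' za') an) zs' z0'.
exists (Order.meet m m') => b; rewrite lexI; split=> [Iab|/andP[/mP ? /mP' ?]].
  apply/andP; split; [apply/mP|apply/mP'].
    exact: dI Iab (ltW za) _.
  exact: dI Iab (ltW za') _.
by rewrite -zz'; exact: ajI.
Qed.

Lemma bi_join_seq_capped : exists r : seq (A * B),
  I = \bigcup_(p in [set` r]) pure_tensor p.1 p.2.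
Proof.
have [dI bI _ _] := iI.
(* [f a] is the greatest element of the fiber at a nonzero [a] in [s]. The fiber at [\bot] is all of
   [B] and may have no greatest element, so [\bot] is chosen there, and also as default outside
   [s]. *)
have /choice[f fP] : forall a, exists m, a \in s ->
    I (a, m) /\ (a != \bot -> forall b, I (a, b) -> b <= m).
  move=> a; have [->|a0] := eqVneq a \bot.
    by exists \bot => _; split=> //; apply: bI; left.
  have [as_|_] := boolP (a \in s); last by exists \bot.
  have [m mP] := fiber_principal as_ a0.
  by exists m => _; split=> [|_ b /mP//]; exact/mP.
exists [seq (a, f a) | a <- s]; apply/seteqP; split=> [[x y] Ixy|p]; last first.
  move=> [_ /mapP[a as_ ->]]; apply: pure_tensor_sub => //.
  by case: (fP a as_).
(* Every pure tensor contains [bi_bot], so it suffices that the union is nonempty; [\bot \in s]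
   ensures this. *)
have bb : bi_bot (x, y) ->
    (\bigcup_(p in [set` [seq (a, f a) | a <- s]]) pure_tensor p.1 p.2) (x, y).
  by exists (\bot, f \bot); [exact: (map_f (fun a => (a, f a)))|left].
have [y0|[a [as_ xa Iay]]] := bi_join_seq_cover Ixy; first by apply: bb; right.
have [aE|a0] := eqVneq a \bot.
  by apply: bb; left; apply/eqP; rewrite -lex0 -aE.
exists (a, f a); first exact: (map_f (fun a => (a, f a))).
by right; split=> //=; have [_] := fP a as_; apply.
Qed.

End Capped.

Theorem theorem3 (dA dB : Order.disp_t)
    (A : bLatticeType dA) (B : bLatticeType dB)
    (hA : locally_finite A) :
  is_lattice (tensor A B) <-> capped_tensor A B.
Proof.
split=> [lat I|]; last exact: capped_lattice.
have [t ->] := tensorP I.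
(* Adding [\bot] to the first coordinates of the generators makes it a member of the finite
   sublattice. *)
have [s ts s_sub] := locally_finite_seq (\bot :: map fst t) hA.
apply: (@bi_join_seq_capped _ _ _ _ s) => // [|p pt]; apply: ts.
  exact: mem_head.
by rewrite inE map_f ?orbT.
Qed.
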